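(* Let $X$ be a real Banach space with $\dim X\ge 2$. Then $X$ is a Hilbert space (i.e. its norm is induced by an inner product) if and only if $S_P(X)=0$.
   Context: For a real Banach space $X$ with unit sphere $S_X$, the P-angle constant is $S_P(X)=\sup\left\{\frac{\|x+y\|^2+\|x-y\|^2-4}{2\|x+y\|\,\|x-y\|}: x,y\in S_X,\ x\neq \pm y\right\}$ (this is the supremum of $\cos\operatorname{ang}_P(x+y,x-y)$, where $\operatorname{ang}_P(u,v)=\arccos\frac{\|u\|^2+\|v\|^2-\|u-v\|^2}{2\|u\|\|v\|}$). *)

(* Defs.v *)
From HB Require Import structures.
From mathcomp Require Import all_boot all_order all_algebra.
From mathcomp Require Import all_classical all_reals all_analysis.
Set Implicit Arguments. Unset Strict Implicit. Unset Printing Implicit Defensive.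
Import Order.TTheory GRing.Theory Num.Theory.
Import numFieldNormedType.Exports.
Local Open Scope classical_set_scope.
Local Open Scope ring_scope.

Definition dim_ge2 (R : realType) (X : normedModType R) : Prop :=
  exists x y : X, forall a b : R, a *: x + b *: y = 0 -> a = 0 /\ b = 0.

Definition norm_from_inner_product (R : realType) (X : normedModType R) : Prop :=
  exists ip : X -> X -> R,
    [/\ (forall x y, ip x y = ip y x),
        (forall a x y z, ip (a *: x + y) z = a * ip x z + ip y z),
        (forall x, 0 <= ip x x),
        (forall x, ip x x = 0 -> x = 0)
      & (forall x, `|x| = Num.sqrt (ip x x))].

Definition P_angle_values (R : realType) (X : normedModType R) : set R :=
  [set t | exists x y : X, [/\ `|x| = 1, `|y| = 1, x != y, x != - y &
     t = (`|x + y| ^+ 2 + `|x - y| ^+ 2 - 4) / (2 * `|x + y| * `|x - y|)]].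

Definition S_P (R : realType) (X : normedModType R) : R := sup (P_angle_values X).

(* Main.v *)
(** If the norm comes from an inner product, the parallelogram law makes every
    P-angle value zero. Conversely, [S_P X = 0] gives
    [`|x + y| ^+ 2 + `|x - y| ^+ 2 <= 4] for unit vectors. In the plane spanned
    by two independent vectors take the Loewner ellipse, i.e. the nonnegative
    quadratic form q of maximal discriminant below the squared norm N; it
    touches N along two independent directions, since otherwise it could be
    perturbed to a form of larger discriminant (Day's argument). If q and N
    agree at unit vectors x and y, then
    4 = q(x+y) + q(x-y) <= N(x+y) + N(x-y) <= 4, so they agree along both
    bisectors. The contact directions are thus closed and stable under
    bisection, so there is no gap between two of them and N = q. Hence the
    squared norm is a quadratic form on each plane, and polarization yields the
    inner product. *)
Require Import Defs.
From mathcomp Require Import all_boot all_order all_algebra.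
From mathcomp Require Import all_classical all_reals all_analysis.
From mathcomp Require Import ring lra.
Import Order.TTheory GRing.Theory Num.Theory.
Import numFieldNormedType.Exports.
Local Open Scope ring_scope.
Local Open Scope classical_set_scope.

(** * Binary quadratic forms and their continuity *)

Definition qform {R : realType} (k : R * R * R) (p : R * R) : R :=
  k.1.1 * p.1 ^+ 2 + 2 * k.1.2 * p.1 * p.2 + k.2 * p.2 ^+ 2.

(** For positive definite [k] the ellipse [qform k <= 1] has area pi over the square root of
    [disc k], so a maximal [disc] means a minimal area. *)
Definition disc {R : realType} (k : R * R * R) : R := k.1.1 * k.2 - k.1.2 ^+ 2.

Definition det2 {R : realType} (x y : R * R) : R := x.1 * y.2 - x.2 * y.1.

Definition homogeneous2 {R : realType} (G : R * R -> R) : Prop :=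
  forall c a b, G (c * a, c * b) = c ^+ 2 * G (a, b).

Definition positive2 {R : realType} (G : R * R -> R) : Prop :=
  forall p, p != (0, 0) -> 0 < G p.

Lemma pair_neq0 {R : realType} (p : R * R) :
  (p != (0, 0)) = (0 < p.1 ^+ 2 + p.2 ^+ 2).
Proof.
case: p => a b; rewrite xpair_eqE /= lt_neqAle addr_ge0 ?sqr_ge0 // andbT.
by rewrite [0 == _]eq_sym paddr_eq0 ?sqr_ge0 // !sqrf_eq0.
Qed.

Lemma continuous_qform {R : realType} (k : R * R * R) : continuous (qform k).
Proof.
move=> p; rewrite /qform.
have h1 : (fun q : R * R => q.1) @ p --> p.1 by exact: cvg_fst.
have h2 : (fun q : R * R => q.2) @ p --> p.2 by exact: cvg_snd.
apply: cvgD; first apply: cvgD.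
- by apply: cvgM; [exact: cvg_cst | apply: cvgM].
- by apply: cvgM => //; apply: cvgM => //; exact: cvg_cst.
- by apply: cvgM; [exact: cvg_cst | apply: cvgM].
Qed.

Lemma continuous_det2 {R : realType} (x : R * R) : continuous (det2 x).
Proof.
move=> p; rewrite /det2.
have h1 : (fun q : R * R => q.1) @ p --> p.1 by exact: cvg_fst.
have h2 : (fun q : R * R => q.2) @ p --> p.2 by exact: cvg_snd.
by apply: cvgB; apply: cvgM => //; exact: cvg_cst.
Qed.

Lemma coef_cvg {R : realType} (k : R * R * R) :
  [/\ (fun q : R * R * R => q.1.1) @ k --> k.1.1,
      (fun q : R * R * R => q.1.2) @ k --> k.1.2 &
      (fun q : R * R * R => q.2) @ k --> k.2].
Proof.
have h : (fun q : R * R * R => q.1) @ k --> k.1 by exact: cvg_fst.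
split; last exact: cvg_snd.
- by apply: (cvg_comp _ _ h); exact: cvg_fst.
- by apply: (cvg_comp _ _ h); exact: cvg_snd.
Qed.

Lemma continuous_qform_coef {R : realType} (p : R * R) :
  continuous (qform^~ p).
Proof.
move=> k; rewrite /qform; have [h1 h2 h3] := coef_cvg k.
apply: cvgD; first apply: cvgD.
- by apply: cvgM => //; exact: cvg_cst.
- do 2 (apply: cvgM; last exact: cvg_cst).
  by apply: cvgM => //; exact: cvg_cst.
- by apply: cvgM => //; exact: cvg_cst.
Qed.

Lemma continuous_disc {R : realType} : continuous (@disc R).
Proof.
move=> k; rewrite /disc; have [h1 h2 h3] := coef_cvg k.
by apply: cvgB; [apply: cvgM | apply: cvgM].
Qed.

(** * Closed sets and minima on the unit circle *)

Lemma closed_ge_continuous {R : realType} (T : topologicalType) (f : T -> R) c :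
  continuous f -> closed [set x | c <= f x].
Proof.
move=> cf; apply: (@preimage_closed _ _ f [set y | c <= y]).
  by move=> x _; exact: cf.
exact: closed_ge.
Qed.

Lemma closed_le_continuous {R : realType} (T : topologicalType) (f : T -> R) c :
  continuous f -> closed [set x | f x <= c].
Proof.
move=> cf; apply: (@preimage_closed _ _ f [set y | y <= c]).
  by move=> x _; exact: cf.
exact: closed_le.
Qed.

Lemma closed_eq_continuous {R : realType} (T : topologicalType) (f : T -> R) c :
  continuous f -> closed [set x | f x = c].
Proof.
move=> cf; apply: (@preimage_closed _ _ f [set y | y = c]).
  by move=> x _; exact: cf.
exact: closed_eq.
Qed.

Lemma compact_circle {R : realType} :
  compact [set p : R * R | p.1 ^+ 2 + p.2 ^+ 2 = 1].
Proof.
have bc : compact (`[-1, 1]%classic `*` `[-1, 1]%classic : set (R * R)).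
  by apply: compact_setX; exact: segment_compact.
apply: (subclosed_compact _ bc).
- have -> : [set p : R * R | p.1 ^+ 2 + p.2 ^+ 2 = 1] =
            [set p | qform (1, 0, 1) p = 1].
    by apply/seteqP; split => p /=; rewrite /qform /= !mul1r mulr0 !mul0r addr0.
  apply: closed_eq_continuous; exact: continuous_qform.
- move=> [a b] /= h; split => /=; rewrite in_itv /= -ler_norml;
  rewrite -(@ler_pXn2r _ 2) ?nnegrE // expr1n real_normK ?num_real //;
  have := sqr_ge0 a; have := sqr_ge0 b; lra.
Qed.

(** The minimum over the unit circle is positive, and homogeneity of degree 2 spreads it to the
    plane. *)
Lemma homogeneous2_lower_bound {R : realType} (G : R * R -> R) :
  continuous G -> homogeneous2 G -> positive2 G ->
  exists2 c, 0 < c & forall p, c * (p.1 ^+ 2 + p.2 ^+ 2) <= G p.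
Proof.
move=> cG hG pG.
have [|e] := @compact_EVT_min _ R G _ _ (@compact_circle R)
  (continuous_subspaceT cG).
  by exists (1, 0) => /=; ring.
rewrite inE /= => e1 emin; exists (G e).
  by apply: pG; rewrite pair_neq0 e1.
move=> [a b] /=; set s := _ + _.
have [s0|s0] := eqVneq s 0.
  rewrite s0 mulr0.
  have [-> ->] : a = 0 /\ b = 0.
    move/eqP: s0; rewrite /s paddr_eq0 ?sqr_ge0 // !sqrf_eq0.
    by case/andP => /eqP -> /eqP ->.
  by have := hG 0 0 0; rewrite mul0r expr0n /= mul0r => ->.
have sp : 0 < s by rewrite lt_neqAle eq_sym s0 addr_ge0 ?sqr_ge0.
have r0 : Num.sqrt s != 0 by rewrite gt_eqF // sqrtr_gt0.
have rr : Num.sqrt s ^+ 2 = s by rewrite sqr_sqrtr // ltW.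
have := emin ((Num.sqrt s)^-1 * a, (Num.sqrt s)^-1 * b).
rewrite inE /= hG !exprMn -mulrDr exprVn rr => /(_ (mulVf s0)).
by rewrite mulrC ler_pdivlMr.
Qed.

Lemma homogeneous2_qform {R : realType} (k : R * R * R) :
  homogeneous2 (qform k).
Proof. by move=> c a b; rewrite /qform /=; ring. Qed.

(** * The Loewner form and its contact directions *)

Definition sub_qform {R : realType} (G : R * R -> R) : set (R * R * R) :=
  [set k | forall p, 0 <= qform k p <= G p].

(** Values on the axes bound the outer coefficients; nonnegativity at [(1, 1)] and [(1, -1)] bounds
    the middle one by their mean. *)
Lemma compact_sub_qform {R : realType} (G : R * R -> R) :
  compact (sub_qform G).
Proof.
set M := G (1, 0); set M' := G (0, 1).
have bc : compact (`[0, M]%classic `*` `[- (M + M'), M + M']%classic `*`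
    `[0, M']%classic : set (R * R * R)).
  by do 2 (apply: compact_setX; last exact: segment_compact);
     exact: segment_compact.
apply: (subclosed_compact _ bc).
- have -> : sub_qform G = \bigcap_(p in [set: R * R])
     ([set k | 0 <= qform k p] `&` [set k | qform k p <= G p]).
    apply/seteqP; split => k /= h; first by move=> p _; split; case/andP: (h p).
    by move=> p; have [? ?] := h p I; apply/andP.
  apply: closed_bigI => p _; apply: closedI.
    by apply: closed_ge_continuous; exact: continuous_qform_coef.
  by apply: closed_le_continuous; exact: continuous_qform_coef.
- move=> [[A B] C] /= h.
  have := h (1, 0); have := h (0, 1); have := h (1, 1); have := h (1, -1).
  rewrite /qform /= -/M -/M'.
  move=> /andP[h1 _] /andP[h2 _] /andP[h3 h4] /andP[h5 h6].
  split; first split; rewrite /= in_itv /=; apply/andP; split; lra.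
Qed.

(** [disc] attains its maximum by compactness, and a small multiple of the Euclidean form is a
    competitor that makes this maximum positive. *)
Lemma loewner_exists {R : realType} (G : R * R -> R) :
  continuous G -> homogeneous2 G -> positive2 G ->
  exists k, [/\ sub_qform G k, 0 < k.1.1, 0 < disc k &
    forall k', sub_qform G k' -> disc k' <= disc k].
Proof.
move=> cG hG pG.
have [c c0 cP] := homogeneous2_lower_bound G cG hG pG.
have kc : sub_qform G (c, 0, c).
  move=> p; have := cP p; rewrite /qform /= => h; apply/andP; split.
    by rewrite mulr0 !mul0r addr0 -mulrDr mulr_ge0 ?addr_ge0 ?sqr_ge0 // ltW.
  by apply: le_trans h; lra.
have [|k] := @compact_EVT_max _ R (@disc R) _ _ (compact_sub_qform G)
  (continuous_subspaceT (@continuous_disc R)).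
  by exists (c, 0, c).
rewrite inE => kG kmax.
have kpos : 0 < disc k.
  apply: lt_le_trans (kmax (c, 0, c) _); last by rewrite inE.
  by rewrite /disc /= expr0n /= subr0 mulr_gt0.
exists k; split => //; last by move=> k' hk'; apply: kmax; rewrite inE.
rewrite lt_neqAle; apply/andP; split.
  apply/eqP => k0; move: kpos; rewrite /disc -k0 mul0r.
  by have := sqr_ge0 k.1.2; lra.
have /andP[+ _] := kG (1, 0); rewrite /qform /=; lra.
Qed.

Lemma positive2_qform {R : realType} (k : R * R * R) :
  0 < k.1.1 -> 0 < disc k -> positive2 (qform k).
Proof.
case: k => [[A B] C]; rewrite /disc /qform /= => A0 D0 [a b].
rewrite pair_neq0 /= => ab; rewrite -(pmulr_rgt0 _ A0).
have -> : A * (A * a ^+ 2 + 2 * B * a * b + C * b ^+ 2) =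
          (A * a + B * b) ^+ 2 + (A * C - B ^+ 2) * b ^+ 2 by ring.
have [b0|b0] := eqVneq b 0.
  move: ab; rewrite b0 expr0n /= !mulr0 !addr0 exprMn => ab.
  by rewrite mulr_gt0 // exprn_gt0.
rewrite ltr_wpDl ?sqr_ge0 // mulr_gt0 //.
by rewrite lt_neqAle eq_sym sqrf_eq0 b0 sqr_ge0.
Qed.

Lemma contact_independent {R : realType} {G : R * R -> R} {k : R * R * R}
    {x : R * R} :
  continuous G -> homogeneous2 G -> sub_qform G k -> 0 < k.1.1 -> 0 < disc k ->
  (forall k', sub_qform G k' -> disc k' <= disc k) -> x != (0, 0) ->
  exists p, [/\ p != (0, 0), G p = qform k p & det2 x p != 0].
Proof.
move=> cG hG kG k0 D0 kmax x0.
have pq := positive2_qform k k0 D0.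
have q0 := pq x x0.
set D := disc k in D0; set m := qform k x in q0.
(* Otherwise [(1 - e) q + (3 e D / q(x)) det2(x, .)^2] is still below [G] for
   small [e > 0]: where [m * q > 3 D det2(x, .)^2] it is below [q], elsewhere
   [G - q] is bounded away from [0]. Its discriminant is
   [(1 - e) (1 + 2 e) D > D]. *)
apply: contrapT => nex.
set H := fun p =>
  Num.max (G p - qform k p) (m * qform k p - 3 * D * det2 x p ^+ 2).
have cH1 : continuous (fun p => G p - qform k p).
  by move=> p; apply: cvgB; [exact: cG | exact: continuous_qform].
have cH2 : continuous (fun p => m * qform k p - 3 * D * det2 x p ^+ 2).
  move=> p; apply: cvgB.
    by apply: cvgM; [exact: cvg_cst | exact: continuous_qform].
  apply: cvgM; first exact: cvg_cst.
  by apply: cvgM; exact: continuous_det2.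
have cH : continuous H.
  by move=> p; exact: continuous_max (cH1 p) (cH2 p).
have hH : homogeneous2 H.
  move=> c a b; rewrite /H hG homogeneous2_qform maxr_pMr ?sqr_ge0 //.
  by congr Num.max; rewrite /det2 /=; ring.
(* Where the first branch vanishes, [p] is a contact, hence parallel to [x] by [nex]; the second
   branch is then [m * qform k p], which is positive. *)
have pH : positive2 H.
  move=> p p0; rewrite /H lt_max; apply/orP.
  have [h|h] := ltrP 0 (G p - qform k p); [by left | right].
  have e : G p = qform k p.
    by apply/eqP; rewrite eq_le -subr_le0 h /=; case/andP: (kG p).
  have [d0|d0] := eqVneq (det2 x p) 0; last by case: nex; exists p.
  by rewrite d0 expr0n /= mulr0 subr0 mulr_gt0 // pq.
have [c c0 cP] := homogeneous2_lower_bound H cH hH pH.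
set s := x.1 ^+ 2 + x.2 ^+ 2.
have s0 : 0 < s by rewrite -pair_neq0.
(* Cauchy-Schwarz through Lagrange's identity. *)
have CS p : det2 x p ^+ 2 <= s * (p.1 ^+ 2 + p.2 ^+ 2).
  have -> : s * (p.1 ^+ 2 + p.2 ^+ 2) =
      det2 x p ^+ 2 + (x.1 * p.1 + x.2 * p.2) ^+ 2 by rewrite /s /det2; ring.
  by rewrite lerDl sqr_ge0.
set M := 3 * D * s.
have M0 : 0 < M by rewrite !mulr_gt0.
(* The bound 1/4 keeps [1 - 2 * e] positive; [c * m / M] keeps the added term below [c] times the
   squared Euclidean length. *)
pose e := Num.min (4^-1) (c * m / M).
have e0 : 0 < e by rewrite lt_min invr_gt0 ltr0n /= divr_gt0 ?mulr_gt0.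
have e4 : e <= 4^-1 by rewrite ge_min lexx.
have ec : e * M <= c * m.
  by rewrite -ler_pdivlMr // ge_min lexx orbT.
set f := 3 * e * D / m.
have f0 : 0 < f by rewrite divr_gt0 // !mulr_gt0.
pose k' := ((1 - e) * k.1.1 + f * x.2 ^+ 2, (1 - e) * k.1.2 - f * (x.1 * x.2),
            (1 - e) * k.2 + f * x.1 ^+ 2).
have qk' p : qform k' p = (1 - e) * qform k p + f * det2 x p ^+ 2.
  by rewrite /qform /det2 /=; ring.
have k'G : sub_qform G k'.
  move=> p; rewrite qk'; have /andP[kp0 kp1] := kG p.
  have d2 := sqr_ge0 (det2 x p).
  have fd : 0 <= f * det2 x p ^+ 2 by rewrite mulr_ge0 // ltW.
  apply/andP; split.
    by rewrite addr_ge0 // mulr_ge0 //; lra.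
  have fm : m * (f * det2 x p ^+ 2) = e * (3 * D * det2 x p ^+ 2).
    by rewrite /f; field; rewrite gt_eqF.
  rewrite -(ler_pM2l q0) mulrDr fm.
  (* In the first branch the gap between [G] and [q] absorbs the added term; in the second the new
     form is already below [q]. *)
  have := cP p; rewrite /H le_max => /orP[h|h].
    have h1 : m * (c * (p.1 ^+ 2 + p.2 ^+ 2)) <= m * (G p - qform k p).
      by rewrite ler_pM2l.
    have h2 : e * (3 * D * det2 x p ^+ 2) <= e * M * (p.1 ^+ 2 + p.2 ^+ 2).
      rewrite /M -!mulrA ler_pM2l // ler_pM2l ?ltr0n // ler_pM2l //; exact: CS.
    have h3 : e * M * (p.1 ^+ 2 + p.2 ^+ 2) <= c * m * (p.1 ^+ 2 + p.2 ^+ 2).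
      by rewrite ler_wpM2r // addr_ge0 ?sqr_ge0.
    have h4 : 0 <= m * (e * qform k p) by rewrite !mulr_ge0 // ltW.
    lra.
  have h0 : 0 <= c * (p.1 ^+ 2 + p.2 ^+ 2).
    by rewrite mulr_ge0 ?addr_ge0 ?sqr_ge0 // ltW.
  have h1 : 0 <= e * (m * qform k p - 3 * D * det2 x p ^+ 2).
    by rewrite mulr_ge0 ?(ltW e0) // (le_trans h0).
  have h2 : m * qform k p <= m * G p by rewrite ler_pM2l.
  lra.
have := kmax _ k'G.
have -> : disc k' = (1 - e) * (1 + 2 * e) * D.
  (* The added form has rank one, so its own discriminant is 0 and the mixed term is [(1 - e) * f]
     times [q(x) = m]. *)
  have -> : disc k' = (1 - e) ^+ 2 * D + (1 - e) * f * m.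
    by rewrite /m /D /disc /qform /=; ring.
  by rewrite /f; field; rewrite gt_eqF.
rewrite -/D => h.
have : 0 < D * (e * (1 - 2 * e)).
  by rewrite !mulr_gt0 //; lra.
lra.
Qed.

(** * Coordinates in a basis and two independent contacts *)

Definition comb2 {R : realType} (a b : R) (x y : R * R) : R * R :=
  (a * x.1 + b * y.1, a * x.2 + b * y.2).

Lemma comb2_neq0 {R : realType} {a b : R} {x y : R * R} :
  det2 x y != 0 -> (a != 0) || (b != 0) -> comb2 a b x y != (0, 0).
Proof.
move=> d; apply: contraTneq => -[h1 h2]; rewrite negb_or !negbK.
have /eqP : a * det2 x y = 0.
  rewrite (_ : _ * _ = (a * x.1 + b * y.1) * y.2 - (a * x.2 + b * y.2) * y.1).
    by rewrite h1 h2 !mul0r subr0.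
  by rewrite /det2; ring.
have /eqP : b * det2 x y = 0.
  rewrite (_ : _ * _ = (a * x.2 + b * y.2) * x.1 - (a * x.1 + b * y.1) * x.2).
    by rewrite h1 h2 !mul0r subr0.
  by rewrite /det2; ring.
by rewrite !mulf_eq0 (negbTE d) !orbF => -> ->.
Qed.

Lemma comb2_span {R : realType} {x y : R * R} (p : R * R) :
  det2 x y != 0 -> exists a b, p = comb2 a b x y.
Proof.
(* Cramer's rule. *)
move=> d; exists (det2 p y / det2 x y), (det2 x p / det2 x y).
case: p => p1 p2; rewrite /comb2; congr pair; move: d; rewrite /det2 /= => d;
  by field.
Qed.

Lemma loewner_contacts {R : realType} {G : R * R -> R} :
  continuous G -> homogeneous2 G -> positive2 G ->
  exists k x y, [/\ sub_qform G k, G x = qform k x, G y = qform k y &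
    det2 x y != 0].
Proof.
move=> cG hG pG.
have [k [kG k0 D0 kmax]] := loewner_exists G cG hG pG.
(* Any nonzero vector serves to start; the contact it yields is fed back to get a second,
   independent one. *)
have e0 : (1, 0) != (0, 0) :> R * R by rewrite xpair_eqE oner_eq0.
have [x [x0 ex _]] := contact_independent cG hG kG k0 D0 kmax e0.
have [y [_ ey d]] := contact_independent cG hG kG k0 D0 kmax x0.
by exists k, x, y.
Qed.

(** * Contact directions in the plane of two independent vectors *)

Section Plane.
Context {R : realType} {X : normedModType R}.
Variables (u v : X).
Hypothesis uv_free : forall a b : R, a *: u + b *: v = 0 -> a = 0 /\ b = 0.

Let lc (p : R * R) : X := p.1 *: u + p.2 *: v.
Let G (p : R * R) : R := `|lc p| ^+ 2.

Let lc_comb2 a b x y : lc (comb2 a b x y) = a *: lc x + b *: lc y.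
Proof. by rewrite /lc /= !scalerDr !scalerDl !scalerA addrACA. Qed.

Let lc_eq0 p : (lc p == 0) = (p == (0, 0)).
Proof.
apply/eqP/eqP => [/uv_free[h1 h2]|->]; last by rewrite /lc /= !scale0r addr0.
by rewrite [p]surjective_pairing h1 h2.
Qed.

Let G_continuous : continuous G.
Proof.
move=> p; rewrite /G.
have h : lc q @[q --> p] --> lc p.
  by apply: cvgD; apply: cvgZr_tmp; [exact: cvg_fst | exact: cvg_snd].
by apply: cvgM; apply: cvg_norm.
Qed.

Let G_comb0 a p : G (a * p.1, a * p.2) = a ^+ 2 * G p.
Proof.
rewrite /G.
have -> : (a * p.1, a * p.2) = comb2 a 0 p p by rewrite /comb2 !mul0r !addr0.
by rewrite lc_comb2 scale0r addr0 normrZ exprMn real_normK ?num_real.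
Qed.

Let G_homogeneous : homogeneous2 G.
Proof. by move=> c a b; exact: (G_comb0 c (a, b)). Qed.

Let G_positive : positive2 G.
Proof. by move=> p p0; rewrite exprn_gt0 // normr_gt0 lc_eq0. Qed.

Hypothesis day : forall x y : X, `|x| = 1 -> `|y| = 1 ->
  `|x + y| ^+ 2 + `|x - y| ^+ 2 <= 4.

Let contact_bisector k x y : sub_qform G k ->
  G x = qform k x -> G y = qform k y -> x != (0, 0) -> y != (0, 0) ->
  let z := comb2 (`|lc x|^-1) (`|lc y|^-1) x y in G z = qform k z.
Proof.
move=> kG ex ey x0 y0 /=.
set a := _^-1; set b := _^-1.
have nx : 0 < `|lc x| by rewrite normr_gt0 lc_eq0.
have ny : 0 < `|lc y| by rewrite normr_gt0 lc_eq0.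
have ax : `|a *: lc x| = 1.
  by rewrite normrZ gtr0_norm ?invr_gt0 // mulVf // gt_eqF.
have bY : `|b *: lc y| = 1.
  by rewrite normrZ gtr0_norm ?invr_gt0 // mulVf // gt_eqF.
have := day _ _ ax bY; rewrite -lc_comb2 -scaleNr -lc_comb2.
rewrite -!/(G _).
have /andP[_ h1] := kG (comb2 a b x y).
have /andP[_ h2] := kG (comb2 a (- b) x y).
(* Parallelogram law for [q] at the two normalized contacts, where [q] equals 1; with [h1], [h2] and
   [day] it forces equality at both bisectors. *)
have : qform k (comb2 a b x y) + qform k (comb2 a (- b) x y) = 4.
  have -> : 4 = 2 * (a ^+ 2 * qform k x) + 2 * (b ^+ 2 * qform k y) :> R.
    rewrite -ex -ey /G -!exprMn !mulVf ?gt_eqF // expr1n; ring.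
  by rewrite /qform /comb2 /=; ring.
lra.
Qed.

(** A gap among the contacts on the segment from [x] to [y] would have end points whose bisector
    falls strictly inside it. The midpoint is enough, since [x] and [y] may be rescaled
    beforehand. *)
Let contact_sum k x y : sub_qform G k ->
  G x = qform k x -> G y = qform k y -> det2 x y != 0 ->
  G (comb2 1 1 x y) = qform k (comb2 1 1 x y).
Proof.
move=> kG ex ey d.
pose seg t := comb2 (1 - t) t x y.
pose E : set R := [set t | G (seg t) - qform k (seg t) = 0].
have seg0 t : seg t != (0, 0).
  apply: comb2_neq0 => //; have [->|_] := eqVneq t 0; last by rewrite orbT.
  by rewrite subr0 oner_eq0.
have segc : continuous seg.
  move=> s0.
  have h (i j : R) : (1 - s) * i + s * j @[s --> s0] --> (1 - s0) * i + s0 * j.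
    apply: cvgD; last by apply: cvgM; [exact: cvg_id | exact: cvg_cst].
    apply: cvgM; last exact: cvg_cst.
    by apply: cvgB; [exact: cvg_cst | exact: cvg_id].
  exact: (cvg_pair (h _ _) (h _ _)).
have Ec : closed E.
  apply: closed_eq_continuous => s0.
  apply: cvgB.
    exact: (@continuous_comp _ _ _ seg G s0 (segc s0) (G_continuous _)).
  exact: (@continuous_comp _ _ _ seg (qform k) s0 (segc s0)
    (continuous_qform _ _)).
have E0 : E 0.
  rewrite /E /seg /=; have -> : comb2 (1 - 0) 0 x y = x.
    by rewrite /comb2 subr0 !mul1r !mul0r !addr0 -surjective_pairing.
  by rewrite ex subrr.
have E1 : E 1.
  rewrite /E /seg /=; have -> : comb2 (1 - 1) 1 x y = y.
    by rewrite /comb2 subrr !mul1r !mul0r !add0r -surjective_pairing.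
  by rewrite ey subrr.
have half0 : 0 <= 2^-1 :> R by lra.
have half1 : 2^-1 <= 1 :> R by lra.
have cE (a b : R) : compact (`[a, b]%classic `&` E).
  by apply: compact_closedI => //; exact: segment_compact.
have idc (A : set R) : {within A, continuous (@id R)}.
  by apply: continuous_subspaceT => s0; exact: cvg_id.
(* [s] is the last contact parameter up to the midpoint, and [r] below is the first one from the
   midpoint on. *)
have [|s] := compact_EVT_max _ (cE 0 2^-1) (idc _).
  by exists 0; split => //=; rewrite in_itv /= lexx half0.
rewrite inE /= in_itv /= => -[/andP[s0 s1] sE] smax.
have [|r] := compact_EVT_min _ (cE 2^-1 1) (idc _).
  by exists 1; split => //=; rewrite in_itv /= lexx half1.
rewrite inE /= in_itv /= => -[/andP[r0 r1] rE] rmin.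
have [sh|sh] := eqVneq s 2^-1.
  move: sE; rewrite sh /E /= => /subr0_eq.
  have -> : seg 2^-1 = (2^-1 * (comb2 1 1 x y).1, 2^-1 * (comb2 1 1 x y).2).
    by rewrite /seg /comb2 /=; congr pair; field.
  rewrite G_comb0 homogeneous2_qform -surjective_pairing.
  by apply: mulfI; rewrite expf_neq0 // invr_eq0 pnatr_eq0.
have {}s1 : s < 2^-1 by rewrite lt_neqAle sh.
have a0 : 0 < `|lc (seg s)|^-1 by rewrite invr_gt0 normr_gt0 lc_eq0.
have b0 : 0 < `|lc (seg r)|^-1 by rewrite invr_gt0 normr_gt0 lc_eq0.
have := contact_bisector k (seg s) (seg r) kG (subr0_eq sE) (subr0_eq rE)
  (seg0 _) (seg0 _).
rewrite /=; move: a0 b0; set a := `|_|^-1; set b := `|_|^-1 => a0 b0 ez.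
(* Since [seg] is affine, the bisector of [seg s] and [seg r] is [a + b] times [seg m], with [m] the
   weighted mean of [s] and [r]. *)
pose m := (a * s + b * r) / (a + b).
have ab0 : 0 < a + b by rewrite addr_gt0.
have sm : s < m.
  by rewrite ltr_pdivlMr // mulrDr [s * a]mulrC ltrD2l mulrC ltr_pM2l //; lra.
have mr : m < r.
  by rewrite ltr_pdivrMr // mulrDr [r * b]mulrC ltrD2r mulrC ltr_pM2r //; lra.
have mE : E m.
  have e : comb2 a b (seg s) (seg r) =
      ((a + b) * (seg m).1, (a + b) * (seg m).2).
    by rewrite /seg /comb2 /m /=; congr pair; field; rewrite gt_eqF.
  move: ez; rewrite e G_comb0 homogeneous2_qform -surjective_pairing.
  by move/mulfI => h; rewrite /E /= h ?subrr // expf_neq0 // gt_eqF.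
(* Whichever half contains [m], this contradicts the extremality of [s] or of [r]. *)
have [mh|mh] := lerP m 2^-1.
  have := smax m; rewrite inE /= in_itv /= mh (le_trans s0 (ltW sm)).
  move=> /(_ (conj isT mE)).
  by rewrite leNgt sm.
have := rmin m; rewrite inE /= in_itv /= (ltW mh) (le_trans (ltW mr) r1).
move=> /(_ (conj isT mE)).
by rewrite leNgt mr.
Qed.

(** Contacts are stable under scaling, so a point [a x + b y] over the two independent contacts is
    the sum of the contacts [a x] and [b y], to which [contact_sum] applies; if a coefficient
    vanishes, scaling alone suffices. *)
Lemma norm_sqr_qform : exists k,
  forall a b, `|a *: u + b *: v| ^+ 2 = qform k (a, b).
Proof.
have [k [x [y [kG ex ey d]]]] :=
  loewner_contacts G_continuous G_homogeneous G_positive.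
exists k => a0 b0; rewrite -[LHS]/(G (a0, b0)).
have [a [b ->]] := comb2_span (a0, b0) d.
have e1 c z :
    G z = qform k z -> G (c * z.1, c * z.2) = qform k (c * z.1, c * z.2).
  by rewrite G_comb0 homogeneous2_qform -surjective_pairing => ->.
have [->|a_neq0] := eqVneq a 0.
  by have := e1 b _ ey; rewrite /comb2 !mul0r !add0r.
have [->|b_neq0] := eqVneq b 0.
  by have := e1 a _ ex; rewrite /comb2 !mul0r !addr0.
have := contact_sum _ _ _ kG (e1 a _ ex) (e1 b _ ey).
rewrite /comb2 /= !mul1r; apply.
have -> : det2 (a * x.1, a * x.2) (b * y.1, b * y.2) = a * b * det2 x y.
  by rewrite /det2 /=; ring.
by rewrite !mulf_neq0.
Qed.
End Plane.

(** * From planes to an inner product *)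

(** Dependent vectors are [s *: x] and [t *: x] for some [x], and the form is then the square of
    [a * s + b * t] scaled by the squared norm of [x]. *)
Lemma norm_sqr_qform_all {R : realType} {X : normedModType R} (u v : X) :
  (forall x y : X, `|x| = 1 -> `|y| = 1 ->
    `|x + y| ^+ 2 + `|x - y| ^+ 2 <= 4) ->
  exists k, forall a b, `|a *: u + b *: v| ^+ 2 = qform k (a, b).
Proof.
move=> day.
have dep (s t : R) (x : X) :
    exists k, forall a b,
      `|a *: (s *: x) + b *: (t *: x)| ^+ 2 = qform k (a, b).
  exists (`|x| ^+ 2 * s ^+ 2, `|x| ^+ 2 * (s * t), `|x| ^+ 2 * t ^+ 2) => a b.
  rewrite !scalerA -scalerDl normrZ exprMn real_normK ?num_real // /qform /=.
  by ring.
have [uv|/existsNP[a /existsNP[b /not_implyP[h /not_andP hab]]]] :=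
  pselect (forall a b : R, a *: u + b *: v = 0 -> a = 0 /\ b = 0).
  exact: norm_sqr_qform uv day.
have [a0|a0] := eqVneq a 0; last first.
  have -> : u = (- (a^-1 * b)) *: v.
    apply: (scalerI a0); rewrite scalerA mulrN mulVKf // scaleNr.
    by apply/eqP; rewrite -addr_eq0; exact/eqP.
  by have := dep (- (a^-1 * b)) 1 v; rewrite scale1r.
have b0 : b != 0 by apply/eqP; case: hab.
have v0 : v = 0 *: u.
  apply: (scalerI b0); rewrite scale0r scaler0.
  by move: h; rewrite a0 scale0r add0r.
by rewrite v0; have := dep 1 0 u; rewrite scale1r.
Qed.

(** Polarization: homogeneity is read off the quadratic form on the span of [x] and [z], and
    additivity comes from the parallelogram law as in Jordan and von Neumann. *)
Lemma qform_norm_inner_product {R : realType} {X : normedModType R} :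
  (forall u v : X, exists k, forall a b,
    `|a *: u + b *: v| ^+ 2 = qform k (a, b)) ->
  norm_from_inner_product X.
Proof.
move=> quad.
pose S (x : X) := `|x| ^+ 2.
have para (x y : X) : S (x + y) + S (x - y) = 2 * S x + 2 * S y.
  have [k kP] := quad x y; rewrite /S.
  have := kP 1 1; have := kP 1 (-1); have := kP 1 0; have := kP 0 1.
  rewrite !scale1r !scale0r scaleN1r add0r addr0 => -> -> -> ->.
  by rewrite /qform /=; ring.
have SN x : S (- x) = S x by rewrite /S normrN.
have S2 (x : X) : S (x *+ 2) = 4 * S x.
  by rewrite /S normrMn exprMn_n mulr_natl.
exists (fun x y => (S (x + y) - S (x - y)) / 4); split.
- by move=> x y; rewrite (addrC x y) -[S (x - y)]SN opprB.
- move=> a x y z.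
  have Z : S (a *: x + z) - S (a *: x - z) = a * (S (x + z) - S (x - z)).
    have [k kP] := quad x z; rewrite /S.
    have := kP a 1; have := kP a (-1); have := kP 1 1; have := kP 1 (-1).
    rewrite !scale1r scaleN1r => -> -> -> ->.
    by rewrite /qform /=; ring.
  suff D : S (a *: x + y + z) - S (a *: x + y - z) =
      (S (a *: x + z) - S (a *: x - z)) + (S (y + z) - S (y - z)).
    by rewrite D Z; field.
  move: (a *: x) => w {Z}.
  (* In order of appearance, first law minus second plus third minus fourth: the terms in
     [w + z - y] and [w - z - y] cancel. *)
  have := para (w + z) y; have := para (w - z) y.
  have := para (y + z) w; have := para (y - z) w.
  have -> : y - z + w = w + y - z by rewrite addrC addrA.
  have -> : y + z + w = w + y + z by rewrite addrC addrA.
  have -> : w + z + y = w + y + z by rewrite addrAC.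
  have -> : w - z + y = w + y - z by rewrite addrAC.
  have -> : y - z - w = - (w + z - y).
    by rewrite !opprD opprK addrC addrA [RHS]addrAC addrAC.
  have -> : y + z - w = - (w - z - y).
    by rewrite !opprD !opprK addrC addrA [RHS]addrAC addrAC.
  rewrite !SN; lra.
- move=> x; rewrite subrr /S normr0 expr0n /= subr0.
  by rewrite mulr_ge0 ?sqr_ge0 ?invr_ge0.
- move=> x; rewrite subrr -mulr2n S2 /S normr0 expr0n /= subr0.
  rewrite mulrAC divff ?mul1r ?pnatr_eq0 //.
  by move/eqP; rewrite sqrf_eq0 normr_eq0 => /eqP.
- move=> x; rewrite subrr -mulr2n S2 /S normr0 expr0n /= subr0.
  rewrite mulrAC divff ?mul1r ?pnatr_eq0 //.
  by rewrite sqrtr_sqr normr_id.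
Qed.

(** * The P-angle values and their supremum *)

Lemma inner_product_parallelogram {R : realType} {X : normedModType R}
    (x y : X) :
  norm_from_inner_product X ->
  `|x + y| ^+ 2 + `|x - y| ^+ 2 = 2 * (`|x| ^+ 2 + `|y| ^+ 2).
Proof.
move=> [ip [ipC ipL ip0 _ ipN]].
have N2 z : `|z| ^+ 2 = ip z z by rewrite ipN sqr_sqrtr.
have ipLr a u v w : ip w (a *: u + v) = a * ip w u + ip w v.
  by rewrite ipC ipL !(ipC _ w).
have e (c : R) : ip (c *: y + x) (c *: y + x) =
    c ^+ 2 * ip y y + 2 * c * ip x y + ip x x.
  by rewrite ipL !ipLr (ipC y x); ring.
have := e 1; have := e (-1); rewrite scale1r scaleN1r !(addrC _ x) !N2 => -> ->.
by ring.
Qed.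

(** After clearing the denominator, the claim is that the norms of [x + y] and [x - y] differ by at
    most 2. The bound makes [sup] a true supremum: on an unbounded set it would default to 0. *)
Lemma P_angle_values_le1 {R : realType} {X : normedModType R} :
  ubound (P_angle_values X) 1.
Proof.
move=> _ [x [y [nx ny xy xNy ->]]].
have p0 : 0 < `|x + y| by rewrite normr_gt0 addr_eq0.
have m0 : 0 < `|x - y| by rewrite normr_gt0 subr_eq0.
rewrite ler_pdivrMr ?mulr_gt0 // mul1r -subr_ge0.
have t : `|x + y| <= `|x - y| + 2.
  have -> : x + y = (x - y) + y *+ 2 by rewrite mulr2n addrA subrK.
  by rewrite (le_trans (ler_normD _ _)) // normrMn ny.
have t' : `|x - y| <= `|x + y| + 2.
  have -> : x - y = (x + y) - y *+ 2 by rewrite mulr2n opprD addrA addrK.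
  by rewrite (le_trans (ler_normB _ _)) // normrMn ny.
rewrite (_ : _ - _ = (2 - (`|x + y| - `|x - y|)) * (2 + (`|x + y| - `|x - y|))).
  by apply: mulr_ge0; lra.
by ring.
Qed.

(** Normalized independent vectors are neither equal nor opposite. *)
Lemma P_angle_values_nonempty {R : realType} {X : normedModType R} :
  dim_ge2 X -> P_angle_values X !=set0.
Proof.
move=> [x [y xy]].
have x0 : `|x| != 0.
  rewrite normr_eq0; apply/eqP => e; have [] := xy 1 0.
    by rewrite e scaler0 scale0r addr0.
  by move/eqP; rewrite oner_eq0.
have y0 : `|y| != 0.
  rewrite normr_eq0; apply/eqP => e; have [] := xy 0 1.
    by rewrite e scaler0 scale0r addr0.
  by move=> _ /eqP; rewrite oner_eq0.
have unit (z : X) : `|z| != 0 -> `| `|z|^-1 *: z| = 1.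
  by move=> z0; rewrite normrZ normfV normr_id mulVf.
pose x' := `|x|^-1 *: x; pose y' := `|y|^-1 *: y.
exists ((`|x' + y'| ^+ 2 + `|x' - y'| ^+ 2 - 4) /
  (2 * `|x' + y'| * `|x' - y'|)).
exists x', y'; split => //; try exact: unit.
- rewrite -subr_eq0 /x' /y' -scaleNr; apply/eqP => /xy[/eqP].
  by rewrite invr_eq0 (negbTE x0).
- rewrite -addr_eq0 /x' /y'; apply/eqP => /xy[/eqP].
  by rewrite invr_eq0 (negbTE x0).
Qed.

(** For the pairs [x = y] and [x = - y], excluded from the values, the sum is exactly 4; otherwise
    the quotient has the sign of its numerator. *)
Lemma S_P_le0_day {R : realType} {X : normedModType R} (x y : X) :
  S_P X <= 0 -> `|x| = 1 -> `|y| = 1 -> `|x + y| ^+ 2 + `|x - y| ^+ 2 <= 4.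
Proof.
move=> SP nx ny.
have n2 (z : X) : `|z| = 1 -> `|z + z| ^+ 2 = 4.
  by move=> nz; rewrite -mulr2n normrMn nz -natrX.
have [->|xy] := eqVneq x y; first by rewrite subrr normr0 expr0n addr0 n2.
have [->|xNy] := eqVneq x (- y).
  by rewrite addNr normr0 expr0n add0r -opprD normrN n2.
have p0 : 0 < `|x + y| by rewrite normr_gt0 addr_eq0.
have m0 : 0 < `|x - y| by rewrite normr_gt0 subr_eq0.
have : (`|x + y| ^+ 2 + `|x - y| ^+ 2 - 4) / (2 * `|x + y| * `|x - y|) <= 0.
  apply: le_trans SP; apply: ub_le_sup; last by exists x, y.
  by exists 1; exact: P_angle_values_le1.
by rewrite pmulr_lle0 ?invr_gt0 ?mulr_gt0 // subr_le0.
Qed.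

Theorem theorem3p5 (R : realType) (X : completeNormedModType R) :
  dim_ge2 X -> (norm_from_inner_product X <-> S_P X = 0).
Proof.
move=> dimX; split => [ipX|SP].
  (* The parallelogram law makes every value 0, and nonemptiness turns the inclusion in [[set 0]]
     into an equality. *)
  rewrite /S_P (_ : P_angle_values X = [set 0]) ?sup1 //.
  have val0 t : P_angle_values X t -> t = 0.
    move=> [x [y [nx ny _ _ ->]]].
    rewrite (inner_product_parallelogram x y ipX) nx ny expr1n.
    by rewrite (_ : 2 * _ - _ = 0) ?mul0r //; ring.
  apply/seteqP; split => [t /val0//|_ ->].
  by have [t tP] := P_angle_values_nonempty dimX; rewrite -(val0 t tP).
apply: qform_norm_inner_product => u v; apply: norm_sqr_qform_all => x y.
by apply: S_P_le0_day; rewrite SP.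
Qed.
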